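(* There exists a countably infinite family $\mathscr{M}$ of finite pairwise non-isomorphic subdirectly irreducible Ockham algebras such that each $\mathbf{M}_1\in\mathscr{M}$ has the following properties: (1) there exists a total structure $\mathbf{M}_2=\langle M;u,\preccurlyeq\rangle$ on the universe $M$ of $\mathbf{M}_1$, with $\preccurlyeq$ an order on $M$ and $u\colon M\to M$ an order-reversing map, such that $\mathbf{M}_2$ is compatible with $\mathbf{M}_1$ and $\mathbf{M}_2^{\mathscr{T}}$ yields a full duality between $\mathcal{A}:=\mathsf{ISP}(\mathbf{M}_1)$ and $\mathsf{IS}^0_{\mathrm c}\mathsf{P}(\mathbf{M}_2^{\mathscr{T}})$; (2) (for this $\mathbf{M}_2$) $b(\mathbf{X})=b_0(\mathbf{X})=n_{\mathcal{X}}(\mathbf{X})$, for all $\mathbf{X}$ in $\mathcal{X}:=\mathsf{IS}^0\mathsf{P}(\mathbf{M}_2)$.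
   Context: An Ockham algebra is an algebra $\langle A;\vee,\wedge,f,0,1\rangle$ where $\langle A;\vee,\wedge,0,1\rangle$ is a bounded distributive lattice and $f$ is a dual endomorphism: $f(a\vee b)=f(a)\wedge f(b)$, $f(a\wedge b)=f(a)\vee f(b)$, $f(0)=1$, $f(1)=0$. Order means partial order. All compact spaces are assumed Hausdorff. $\mathscr{T}$ is the discrete topology on the finite set $M$ and $\mathbf{M}_2^{\mathscr{T}}$ is $\mathbf{M}_2$ with $\mathscr{T}$ added. $\mathbf{M}_2$ is compatible with $\mathbf{M}_1$ if $u$ is an endomorphism of $\mathbf{M}_1$ and $\preccurlyeq$ is a subalgebra of $\mathbf{M}_1^2$. $\mathsf{ISP}(\mathbf{M}_1)$: isomorphic copies of non-empty subalgebras of powers of $\mathbf{M}_1$ (with homomorphisms). $\mathcal{X}=\mathsf{IS}^0\mathsf{P}(\mathbf{M}_2)$: isomorphic copies of (possibly empty) substructures of powers of $\mathbf{M}_2$, structure coordinatewise (with order-preserving maps commuting with $u$). $\mathcal{X}_{\mathscr{T}}=\mathsf{IS}^0_{\mathrm c}\mathsf{P}(\mathbf{M}_2^{\mathscr{T}})$: isomorphic copies of (possibly empty) topologically closed substructures of powers of $\mathbf{M}_2^{\mathscr{T}}$ (with continuous homomorphisms). $\mathrm{D}(\mathbf{A}):=\mathcal{A}(\mathbf{A},\mathbf{M}_1)\le(\mathbf{M}_2^{\mathscr{T}})^A$ and $\mathrm{E}(\mathbf{X}):=\mathcal{X}_{\mathscr{T}}(\mathbf{X},\mathbf{M}_2^{\mathscr{T}})\le\mathbf{M}_1^X$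 are the hom-functors between $\mathcal{A}$ and $\mathcal{X}_{\mathscr{T}}$; $\mathbf{M}_2^{\mathscr{T}}$ yields a full duality between $\mathcal{A}$ and $\mathcal{X}_{\mathscr{T}}$ if the evaluation maps $\mathbf{A}\to\mathrm{E}(\mathrm{D}(\mathbf{A}))$ and $\mathbf{X}\to\mathrm{D}(\mathrm{E}(\mathbf{X}))$ are isomorphisms for all $\mathbf{A}\in\mathcal{A}$ and all $\mathbf{X}\in\mathcal{X}_{\mathscr{T}}$. $\mathcal{X}^{\mathrm{ct}}$ is the category of structures $\langle X;u,\preccurlyeq\rangle$ in $\mathcal{X}$ equipped with a compact topology for which $u$ is continuous and $\preccurlyeq$ is closed, with continuous homomorphisms; $\mathcal{X}^{\mathrm{Bt}}$ is its full subcategory of those with zero-dimensional topology (having a basis of clopen sets). $^\flat$ forgets the topology. For $\mathbf{X}\in\mathcal{X}$, the Bohr compactification $b(\mathbf{X})\in\mathcal{X}^{\mathrm{ct}}$ comes with an embedding $\iota_{\mathbf{X}}\colon\mathbf{X}\to b(\mathbf{X})^\flat$ with dense image and is characterised up to isomorphism by: for every $\mathbf{Z}\in\mathcal{X}^{\mathrm{ct}}$ and homomorphism $g\colon\mathbf{X}\to\mathbf{Z}^\flat$ there is a unique continuous homomorphism $h\colon b(\mathbf{X})\to\mathbf{Z}$ with $h\circ\iota_{\mathbf{X}}=g$. $b_0(\mathbf{X})\in\mathcal{X}^{\mathrm{Bt}}$ is defined in the same way with $\mathcal{X}^{\mathrm{Bt}}$ in place of $\mathcal{X}^{\mathrm{ct}}$.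 The natural extension $n_{\mathcal{X}}(\mathbf{X})$ is the topological closure in $(\mathbf{M}_2^{\mathscr{T}})^{\mathcal{X}(\mathbf{X},\mathbf{M}_2)}$ of the image of the evaluation map $x\mapsto(\varphi\mapsto\varphi(x))$. Equality means isomorphism of topological structures commuting with the canonical embeddings of $\mathbf{X}$. *)

(* Defs.v *)
From HB Require Import structures.
From mathcomp Require Import all_boot all_order.
From mathcomp Require Import boolp classical_sets functions cardinality.
From mathcomp Require Import topology.

Set Warnings "-redundant-canonical-projection".

Set Implicit Arguments.
Unset Strict Implicit.
Unset Printing Implicit Defensive.

Import Order.TTheory.

Local Open Scope classical_set_scope.
Local Open Scope order_scope.

Definition to_sub T (S : set T) (x : T) (Sx : S x) : set_type S :=
  exist _ x (mem_set Sx).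

HB.mixin Record isOckham (d : Order.disp_t) T of Order.TBDistrLattice d T := {
  ockneg : T -> T;
  ocknegU : forall a b : T, ockneg (a `|` b) = ockneg a `&` ockneg b;
  ocknegI : forall a b : T, ockneg (a `&` b) = ockneg a `|` ockneg b;
  ockneg0 : ockneg \bot = \top;
  ockneg1 : ockneg \top = \bot
}.

#[short(type="ockhamType")]
HB.structure Definition Ockham d := {T of isOckham d T & Order.TBDistrLattice d T}.

Section OckhamAlgebras.
Variable d : Order.disp_t.

Definition ockham_hom (A B : ockhamType d) (h : A -> B) : Prop :=
  [/\ forall a b, h (a `|` b) = h a `|` h b,
      forall a b, h (a `&` b) = h a `&` h b,
      forall a, h (ockneg a) = ockneg (h a),
      h \bot = \bot & h \top = \top].

Definition ockham_iso (A B : ockhamType d) (h : A -> B) : Prop :=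
  ockham_hom h /\ bijective h.

Definition subalgebra (A : ockhamType d) (S : set A) : Prop :=
  [/\ forall a b, S a -> S b -> S (a `|` b),
      forall a b, S a -> S b -> S (a `&` b),
      forall a, S a -> S (ockneg a),
      S \bot & S \top].

End OckhamAlgebras.

Definition ockham_prod d (I : Type) (A : I -> ockhamType d) : Type :=
  forall i, A i.

Section ProductAlgebra.
Variables (d : Order.disp_t) (I : Type) (A : I -> ockhamType d).
Local Notation P := (ockham_prod A).
Implicit Types x y z : P.

HB.instance Definition _ := gen_eqMixin P.
HB.instance Definition _ := gen_choiceMixin P.

Let pjoin x y : P := fun i => x i `|` y i.
Let pmeet x y : P := fun i => x i `&` y i.
Let ple x y := pmeet x y == x.
Let plt x y := (y != x) && ple x y.

Let ext x y : (forall i, x i = y i) -> x = y.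
Proof. exact: functional_extensionality_dep. Qed.

Let pmeetC : commutative pmeet.
Proof. by move=> x y; apply: ext => i; exact: meetC. Qed.
Let pjoinC : commutative pjoin.
Proof. by move=> x y; apply: ext => i; exact: joinC. Qed.
Let pmeetA : associative pmeet.
Proof. by move=> x y z; apply: ext => i; exact: meetA. Qed.
Let pjoinA : associative pjoin.
Proof. by move=> x y z; apply: ext => i; exact: joinA. Qed.
Let pjoinKI y x : pmeet x (pjoin x y) = x.
Proof. by apply: ext => i; exact: joinKI. Qed.
Let pmeetKU y x : pjoin x (pmeet x y) = x.
Proof. by apply: ext => i; exact: meetKU. Qed.
Let pmeetUl : left_distributive pmeet pjoin.
Proof. by move=> x y z; apply: ext => i; exact: meetUl. Qed.
Let pmeetxx : idempotent_op pmeet.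
Proof. by move=> x; apply: ext => i; exact: meetxx. Qed.

HB.instance Definition _ := @Order.isMeetJoinDistrLattice.Build d P
  ple plt pmeet pjoin (fun _ _ => erefl) (fun _ _ => erefl)
  pmeetC pjoinC pmeetA pjoinA pjoinKI pmeetKU pmeetUl pmeetxx.

Let ple0 x : ((fun i => \bot) : P) <= x.
Proof. by apply/eqP; apply: ext => i; exact: meet0x. Qed.
HB.instance Definition _ := @Order.hasBottom.Build d P (fun i => \bot) ple0.

Let ple1 x : x <= ((fun i => \top) : P).
Proof. by apply/eqP; apply: ext => i; exact: meetx1. Qed.
HB.instance Definition _ := @Order.hasTop.Build d P (fun i => \top) ple1.

Let pneg x : P := fun i => ockneg (x i).
Let pnegU x y : pneg (x `|` y) = pneg x `&` pneg y.
Proof. by apply: ext => i; exact: ocknegU. Qed.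
Let pnegI x y : pneg (x `&` y) = pneg x `|` pneg y.
Proof. by apply: ext => i; exact: ocknegI. Qed.
Let pneg0 : pneg \bot = \top.
Proof. by apply: ext => i; exact: ockneg0. Qed.
Let pneg1 : pneg \top = \bot.
Proof. by apply: ext => i; exact: ockneg1. Qed.

HB.instance Definition _ := @isOckham.Build d P pneg pnegU pnegI pneg0 pneg1.

End ProductAlgebra.

Definition ockham_pow d (M : ockhamType d) (I : Type) : ockhamType d :=
  ockham_prod (fun _ : I => M).

Definition ockham_sub d (A : ockhamType d) (S : set A) (hS : subalgebra S) : Type :=
  set_type S.

Section Subalgebra.
Variables (d : Order.disp_t) (A : ockhamType d) (S : set A) (hS : subalgebra S).
Local Notation B := (ockham_sub hS).
Implicit Types x y z : B.

HB.instance Definition _ := Choice.copy B (set_type S).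

Let mkS a (Sa : S a) : B := to_sub Sa.
Let inS x : S (val x). Proof. exact: set_mem (valP x). Qed.

Let sjoin x y : B := mkS (let: And5 j _ _ _ _ := hS in j _ _ (inS x) (inS y)).
Let smeet x y : B := mkS (let: And5 _ m _ _ _ := hS in m _ _ (inS x) (inS y)).
Let sneg x : B := mkS (let: And5 _ _ n _ _ := hS in n _ (inS x)).
Let sbot : B := mkS (let: And5 _ _ _ b _ := hS in b).
Let stop : B := mkS (let: And5 _ _ _ _ t := hS in t).
Let sle x y := smeet x y == x.
Let slt x y := (y != x) && sle x y.

Let smeetC : commutative smeet.
Proof. by move=> x y; apply: val_inj; exact: meetC. Qed.
Let sjoinC : commutative sjoin.
Proof. by move=> x y; apply: val_inj; exact: joinC. Qed.
Let smeetA : associative smeet.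
Proof. by move=> x y z; apply: val_inj; exact: meetA. Qed.
Let sjoinA : associative sjoin.
Proof. by move=> x y z; apply: val_inj; exact: joinA. Qed.
Let sjoinKI y x : smeet x (sjoin x y) = x.
Proof. by apply: val_inj; exact: joinKI. Qed.
Let smeetKU y x : sjoin x (smeet x y) = x.
Proof. by apply: val_inj; exact: meetKU. Qed.
Let smeetUl : left_distributive smeet sjoin.
Proof. by move=> x y z; apply: val_inj; exact: meetUl. Qed.
Let smeetxx : idempotent_op smeet.
Proof. by move=> x; apply: val_inj; exact: meetxx. Qed.

HB.instance Definition _ := @Order.isMeetJoinDistrLattice.Build d B
  sle slt smeet sjoin (fun _ _ => erefl) (fun _ _ => erefl)
  smeetC sjoinC smeetA sjoinA sjoinKI smeetKU smeetUl smeetxx.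

Let sle0 x : sbot <= x.
Proof. by apply/eqP; apply: val_inj; exact: meet0x. Qed.
HB.instance Definition _ := @Order.hasBottom.Build d B sbot sle0.

Let sle1 x : x <= stop.
Proof. by apply/eqP; apply: val_inj; exact: meetx1. Qed.
HB.instance Definition _ := @Order.hasTop.Build d B stop sle1.

Let snegU x y : sneg (x `|` y) = sneg x `&` sneg y.
Proof. by apply: val_inj; exact: ocknegU. Qed.
Let snegI x y : sneg (x `&` y) = sneg x `|` sneg y.
Proof. by apply: val_inj; exact: ocknegI. Qed.
Let sneg0 : sneg \bot = \top.
Proof. by apply: val_inj; exact: ockneg0. Qed.
Let sneg1 : sneg \top = \bot.
Proof. by apply: val_inj; exact: ockneg1. Qed.

HB.instance Definition _ := @isOckham.Build d B sneg snegU snegI sneg0 sneg1.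

End Subalgebra.

Section OckhamClasses.
Variable d : Order.disp_t.

(* The index type [I] may be empty, so the one-element algebra is not
   subdirectly irreducible. *)
Definition subdirectly_irreducible (A : ockhamType d) : Prop :=
  forall (I : Type) (B : I -> ockhamType d) (h : A -> ockham_prod B),
    ockham_hom h -> injective h ->
    (forall i (b : B i), exists a, h a i = b) ->
    exists i, ockham_iso (fun a => h a i).

(* Subalgebras are nonempty because they contain [\bot] and [\top]. *)
Definition alg_ISP (M A : ockhamType d) : Prop :=
  exists (I : Type) (S : set (ockham_pow M I)) (hS : subalgebra S)
         (h : A -> ockham_sub hS), ockham_iso h.

End OckhamClasses.

Section SquareAlgebra.
Variables (d : Order.disp_t) (A : ockhamType d).
Local Notation P := (A *prod[d] A).
Implicit Types x y : P.

Let qneg x : P := (ockneg x.1, ockneg x.2).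
Let qnegU x y : qneg (x `|` y) = qneg x `&` qneg y.
Proof. by congr pair; exact: ocknegU. Qed.
Let qnegI x y : qneg (x `&` y) = qneg x `|` qneg y.
Proof. by congr pair; exact: ocknegI. Qed.
Let qneg0 : qneg \bot = \top.
Proof. by congr pair; exact: ockneg0. Qed.
Let qneg1 : qneg \top = \bot.
Proof. by congr pair; exact: ockneg1. Qed.

HB.instance Definition _ := @isOckham.Build d P qneg qnegU qnegI qneg0 qneg1.

End SquareAlgebra.

(* Structures <X; u, le>.  No axiom is imposed on [le]: it is a partial order in
   every member of [str_ISP N] as soon as it is one in [N]. *)
Record ostr := OStr {
  ostr_sort :> Type;
  ou : ostr_sort -> ostr_sort;
  ole : ostr_sort -> ostr_sort -> Prop
}.

Definition ostr_hom (X Y : ostr) (h : X -> Y) : Prop :=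
  (forall x, h (ou x) = ou (h x)) /\ (forall x y, ole x y -> ole (h x) (h y)).

Definition ostr_embedding (X Y : ostr) (h : X -> Y) : Prop :=
  [/\ forall x, h (ou x) = ou (h x), injective h &
      forall x y, ole x y <-> ole (h x) (h y)].

Definition ostr_iso (X Y : ostr) (h : X -> Y) : Prop :=
  exists g : Y -> X, [/\ cancel h g, cancel g h, ostr_hom h & ostr_hom g].

Definition ou_closed (X : ostr) (S : set X) : Prop :=
  forall x, S x -> S (ou x).

Section Substructure.
Variables (X : ostr) (S : set X) (hS : ou_closed S).

Definition sub_ou (x : set_type S) : set_type S :=
  to_sub (hS (set_mem (valP x))).

Definition sub_ole (x y : set_type S) : Prop := ole (val x) (val y).

Definition ostr_sub : ostr := OStr sub_ou sub_ole.

End Substructure.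

Definition ostr_pow (N : ostr) (I : Type) : ostr :=
  @OStr (I -> N) (fun x i => ou (x i)) (fun x y => forall i, ole (x i) (y i)).

Definition str_ISP (N X : ostr) : Prop :=
  exists (I : Type) (S : set (ostr_pow N I)) (hS : ou_closed S)
         (h : X -> ostr_sub hS), ostr_iso h.

Record tstr := TStr {
  tstr_sort :> topologicalType;
  tu : tstr_sort -> tstr_sort;
  tle : tstr_sort -> tstr_sort -> Prop
}.

Definition flat (X : tstr) : ostr := OStr (@tu X) (@tle X).

Definition tstr_hom (X Y : tstr) (h : X -> Y) : Prop :=
  continuous h /\ @ostr_hom (flat X) (flat Y) h.

Definition tstr_iso (X Y : tstr) (h : X -> Y) : Prop :=
  exists g : Y -> X, [/\ cancel h g, cancel g h, tstr_hom h & tstr_hom g].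

Definition tstr_sub (X : tstr) (S : set X) (hS : @ou_closed (flat X) S) : tstr :=
  @TStr (set_type S) (@sub_ou (flat X) S hS) (@sub_ole (flat X) S).

Definition tstr_pow (N : tstr) (I : Type) : tstr :=
  @TStr (prod_topology (fun _ : I => N))
    (fun x i => tu (x i)) (fun x y => forall i, tle (x i) (y i)).

(* Both [I] and [S] may be empty. *)
Definition tstr_IScP (N X : tstr) : Prop :=
  exists (I : Type) (S : set (tstr_pow N I))
         (hS : @ou_closed (flat (tstr_pow N I)) S) (h : X -> tstr_sub hS),
    closed S /\ tstr_iso h.

Section AlterEgo.
Variables (d : Order.disp_t) (M : ockhamType d).
Variables (u : M -> M) (le : M -> M -> Prop).

Definition alter_ego : ostr := OStr u le.

Definition alter_egoT : tstr := @TStr (discrete_topology M) u le.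

Definition partial_order : Prop :=
  [/\ forall x, le x x,
      forall x y, le x y -> le y x -> x = y &
      forall x y z, le x y -> le y z -> le x z].

Definition order_reversing : Prop := forall x y, le x y -> le (u y) (u x).

Definition compatible : Prop :=
  ockham_hom u /\ subalgebra [set p : M *prod[d] M | le p.1 p.2].

Hypothesis C : compatible.

Definition dual_set (A : ockhamType d) : set (tstr_pow alter_egoT A) :=
  [set x : A -> M | ockham_hom x].

Lemma dual_set_closed (A : ockhamType d) :
  @ou_closed (flat (tstr_pow alter_egoT A)) (@dual_set A).
Proof.
move=> x [xU xI xN x0 x1]; case: C => -[uU uI uN u0 u1] _; split=> /=.
- by move=> a b; rewrite xU uU.
- by move=> a b; rewrite xI uI.
- by move=> a; rewrite xN uN.
- by rewrite x0.
- by rewrite x1.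
Qed.

(* D(A): the homomorphisms A -> M1 inside the topological power indexed by A. *)
Definition dualD (A : ockhamType d) : tstr := tstr_sub (@dual_set_closed A).

Definition dual_alg (X : tstr) : set (ockham_pow M X) :=
  [set a : X -> M | @tstr_hom X alter_egoT a].

Lemma continuous_discrete (X : topologicalType) (a : X -> discrete_topology M) :
  continuous a <-> forall x, nbhs x [set y | a y = a x].
Proof.
split=> [ac x|aN x V Vax].
  have /(ac x) : nbhs (a x) [set a x] by exact: discrete_set1.
  by rewrite nbhs_simpl.
rewrite nbhs_simpl; apply: filterS (aN x) => y /= ayx.
by rewrite ayx; exact: nbhs_singleton Vax.
Qed.

Lemma dual_alg_subalgebra (X : tstr) : subalgebra (@dual_alg X).
Proof.
case: C => -[uU uI uN u0 u1] [leU leI leN le0 le1]; split.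
- move=> a b [/continuous_discrete ac [au ale]].
  move=> [/continuous_discrete bc [bu ble]]; split; last split.
  + apply/continuous_discrete => x; apply: filterS2 (ac x) (bc x).
    by move=> y /= ay by_; congr (_ `|` _).
  + by move=> x; exact: etrans (congr2 Order.join (au x) (bu x)) (esym (uU _ _)).
  + move=> x y xy.
    exact: (leU (a x, a y) (b x, b y) (ale _ _ xy) (ble _ _ xy)).
- move=> a b [/continuous_discrete ac [au ale]].
  move=> [/continuous_discrete bc [bu ble]]; split; last split.
  + apply/continuous_discrete => x; apply: filterS2 (ac x) (bc x).
    by move=> y /= ay by_; congr (_ `&` _).
  + by move=> x; exact: etrans (congr2 Order.meet (au x) (bu x)) (esym (uI _ _)).
  + move=> x y xy.
    exact: (leI (a x, a y) (b x, b y) (ale _ _ xy) (ble _ _ xy)).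
- move=> a [/continuous_discrete ac [au ale]]; split; last split.
  + apply/continuous_discrete => x; apply: filterS (ac x).
    by move=> y /= ay; congr ockneg.
  + by move=> x; exact: etrans (congr1 ockneg (au x)) (esym (uN _)).
  + by move=> x y xy; exact: (leN (a x, a y) (ale _ _ xy)).
- split; last by split=> [x|x y _]; [rewrite /= u0 | exact: le0].
  by apply/continuous_discrete => x; exact: filterE.
- split; last by split=> [x|x y _]; [rewrite /= u1 | exact: le1].
  by apply/continuous_discrete => x; exact: filterE.
Qed.

(* E(X): the continuous homomorphisms X -> M2 inside the power M1^X. *)
Definition dualE (X : tstr) : ockhamType d := ockham_sub (@dual_alg_subalgebra X).

Lemma eval_alg_subproof (A : ockhamType d) (a : A) :
  @dual_alg (dualD A) (fun x => val x a).
Proof.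
split; last by split=> [x|x y xy] //; exact: xy.
apply/continuous_discrete => x.
have /continuous_discrete pc :
    continuous ((fun f => f a) : prod_topology (fun _ : A => discrete_topology M)
                                 -> discrete_topology M).
  exact: (@proj_continuous A (fun _ => discrete_topology M) a).
have /(_ x) := @initial_continuous (dualD A)
  (prod_topology (fun _ : A => discrete_topology M)) val.
by move=> /(_ _ (pc (val x))); rewrite nbhs_simpl.
Qed.

Definition eval_alg (A : ockhamType d) (a : A) : dualE (dualD A) :=
  to_sub (eval_alg_subproof a).

Lemma eval_str_subproof (X : tstr) (x : X) :
  @dual_set (dualE X) (fun a => val a x).
Proof. by split. Qed.

Definition eval_str (X : tstr) (x : X) : dualD (dualE X) :=
  to_sub (eval_str_subproof x).

Definition full_duality : Prop :=
  (forall A : ockhamType d, alg_ISP M A -> ockham_iso (@eval_alg A)) /\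
  (forall X : tstr, tstr_IScP alter_egoT X -> tstr_iso (@eval_str X)).

End AlterEgo.

Section Compactifications.
Variable N : ostr.

Definition compact_str (Z : tstr) : Prop :=
  [/\ str_ISP N (flat Z), compact [set: Z] /\ hausdorff_space Z,
      continuous (@tu Z) & closed [set p : Z * Z | tle p.1 p.2]].

(* [zero_dimensional] of the library only asks that clopen sets separate
   points. *)
Definition boolean_str (Z : tstr) : Prop :=
  compact_str Z /\ exists B : set (set Z), basis B /\ B `<=` clopen.

(* [b] with [iota] is the Bohr compactification of [X] relative to [K]. *)
Definition compactification (K : tstr -> Prop) (X : ostr)
    (b : tstr) (iota : X -> b) : Prop :=
  [/\ K b, @ostr_embedding X (flat b) iota, dense (range iota) &
      forall (Z : tstr) (g : X -> Z), K Z -> @ostr_hom X (flat Z) g ->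
        exists! h : b -> Z, tstr_hom h /\ h \o iota = g].

Definition bohr := compactification compact_str.
Definition bohr0 := compactification boolean_str.

End Compactifications.

(* Equality of extensions of [X]: isomorphism commuting with the maps from [X]. *)
Definition iso_under (X : ostr) (Y Z : tstr) (i : X -> Y) (j : X -> Z) : Prop :=
  exists h : Y -> Z, tstr_iso h /\ h \o i = j.

Section NaturalExtension.
Variables (d : Order.disp_t) (M : ockhamType d).
Variables (u : M -> M) (le : M -> M -> Prop).
Variable X : ostr.
Local Notation N := (alter_ego u le).
Local Notation NT := (alter_egoT u le).

Definition hom_set : Type := {phi : X -> N | ostr_hom phi}.

Definition nat_eval (x : X) : tstr_pow NT hom_set := fun phi => sval phi x.

Local Notation P := (prod_topology (fun _ : hom_set => discrete_topology M)).

Lemma nat_ext_closed :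
  @ou_closed (flat (tstr_pow NT hom_set)) (closure (range nat_eval)).
Proof.
have uc : continuous ((fun f phi => u (f phi)) : P -> P).
  move=> f; have ? : Filter (nbhs (f : P)) by exact: nbhs_filter.
  apply/cvg_sup => phi.
  move=> A /= [_ [[V oV <-] Vuf VA]]; rewrite nbhs_simpl /=.
  have /cvg_sup/(_ phi) pc : nbhs (f : P) --> (f : P) by [].
  have : nbhs (f : P) [set g | V (u (g phi))].
    apply: pc; exists [set g | V (u (g phi))]; split=> //.
    by exists (u @^-1` V) => //; exact: discrete_open.
  by apply: filterS => g; exact: VA.
move=> x cx V Vux; have /cx := uc x _ Vux.
move=> [_ [[y _ <-] Vy]]; exists (nat_eval (ou y)); split; first by exists (ou y).
suff -> : nat_eval (ou y) = tu (nat_eval y) by [].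
by apply/funext => -[phi [phiu phile]]; exact: phiu.
Qed.

Definition nat_ext : tstr := tstr_sub nat_ext_closed.

Definition nat_ext_map (x : X) : nat_ext :=
  to_sub (subset_closure (imageT nat_eval x)).

End NaturalExtension.

(* Main.v *)
(* For odd [n], let Z/n act on the Boolean algebra 2^n by cyclic shift, and let
   the Ockham operation send [a] to the complement of its shift.  As [n] is odd,
   the n-th iterate of this operation is Boolean complementation and the
   (n+1)-st is the shift, so the algebra is a Boolean algebra with a Z/n-action
   in disguise, and it is simple.  Take the shift for [u] and equality for the
   order.  A homomorphism into 2^n, or a [u]-equivariant map into 2^n, is
   determined by its 0-th coordinate, which is an ultrafilter, respectively an
   arbitrary subset; hence the duality is Stone duality with the Z/n-action
   carried along.  For the same reason the natural extension of [X] is the space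
   of ultrafilters on [X], that is, the Stone-Cech compactification of the
   discrete set [X] with the extended action, which has the universal property
   with respect to all compact Hausdorff targets. *)

From HB Require Import structures.
Require Import Defs.
From mathcomp Require Import all_boot all_order.
From mathcomp Require Import boolp classical_sets functions cardinality topology.

Set Implicit Arguments.
Unset Strict Implicit.
Unset Printing Implicit Defensive.

Import Order.TTheory.

Local Open Scope classical_set_scope.
Local Open Scope order_scope.

(* The phantom [d] selects the display of the order on the carrier. *)
Definition cyc (d : Order.disp_t) (m : nat) : Type := {ffun 'I_m.*2.+1 -> bool}.

(** * The Ockham algebra of bit vectors of odd length *)

Section CyclicAlgebra.
Variables (d : Order.disp_t) (m : nat).
Local Notation cyc := (cyc d m).
Implicit Types x y z : cyc.

HB.instance Definition _ := Choice.copy cyc {ffun 'I_m.*2.+1 -> bool}.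

Let cjoin x y : cyc := [ffun i => x i || y i].
Let cmeet x y : cyc := [ffun i => x i && y i].
Let cle x y := cmeet x y == x.
Let clt x y := (y != x) && cle x y.
Let cneg x : cyc := [ffun i => ~~ x (ordS i)].

Let cmeetC : commutative cmeet.
Proof. by move=> x y; apply/ffunP => i; rewrite !ffunE andbC. Qed.
Let cjoinC : commutative cjoin.
Proof. by move=> x y; apply/ffunP => i; rewrite !ffunE orbC. Qed.
Let cmeetA : associative cmeet.
Proof. by move=> x y z; apply/ffunP => i; rewrite !ffunE andbA. Qed.
Let cjoinA : associative cjoin.
Proof. by move=> x y z; apply/ffunP => i; rewrite !ffunE orbA. Qed.
Let cjoinKI y x : cmeet x (cjoin x y) = x.
Proof. by apply/ffunP => i; rewrite !ffunE; case: (x i). Qed.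
Let cmeetKU y x : cjoin x (cmeet x y) = x.
Proof. by apply/ffunP => i; rewrite !ffunE; case: (x i); case: (y i). Qed.
Let cmeetUl : left_distributive cmeet cjoin.
Proof. by move=> x y z; apply/ffunP => i; rewrite !ffunE andb_orl. Qed.
Let cmeetxx : idempotent_op cmeet.
Proof. by move=> x; apply/ffunP => i; rewrite !ffunE andbb. Qed.

HB.instance Definition _ := @Order.isMeetJoinDistrLattice.Build d cyc
  cle clt cmeet cjoin (fun _ _ => erefl) (fun _ _ => erefl)
  cmeetC cjoinC cmeetA cjoinA cjoinKI cmeetKU cmeetUl cmeetxx.

Let cle0 x : ([ffun=> false] : cyc) <= x.
Proof. by apply/eqP/ffunP => i; rewrite !ffunE. Qed.
HB.instance Definition _ := @Order.hasBottom.Build d cyc [ffun=> false] cle0.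

Let cle1 x : x <= ([ffun=> true] : cyc).
Proof. by apply/eqP/ffunP => i; rewrite !ffunE andbT. Qed.
HB.instance Definition _ := @Order.hasTop.Build d cyc [ffun=> true] cle1.

Let cnegU x y : cneg (x `|` y) = cneg x `&` cneg y.
Proof. by apply/ffunP => i; rewrite !ffunE negb_or. Qed.
Let cnegI x y : cneg (x `&` y) = cneg x `|` cneg y.
Proof. by apply/ffunP => i; rewrite !ffunE negb_and. Qed.
Let cneg0 : cneg \bot = \top.
Proof. by apply/ffunP => i; rewrite !ffunE. Qed.
Let cneg1 : cneg \top = \bot.
Proof. by apply/ffunP => i; rewrite !ffunE. Qed.

HB.instance Definition _ := @isOckham.Build d cyc cneg cnegU cnegI cneg0 cneg1.

End CyclicAlgebra.

(** * Shift and complement as iterates of the Ockham operation *)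

Section Cyclic.
Variables (d : Order.disp_t) (m : nat).
Local Notation n := m.*2.+1.
Local Notation M := (cyc d m : ockhamType d).
Implicit Types x y : M.

Lemma cycU x y i : (x `|` y) i = x i || y i. Proof. exact: ffunE. Qed.
Lemma cycI x y i : (x `&` y) i = x i && y i. Proof. exact: ffunE. Qed.
Lemma cycN x i : (ockneg x) i = ~~ x (ordS i). Proof. exact: ffunE. Qed.
Lemma cyc0 i : (\bot : M) i = false. Proof. exact: ffunE. Qed.
Lemma cyc1 i : (\top : M) i = true. Proof. exact: ffunE. Qed.
Definition cycE := (cycU, cycI, cycN, cyc0, cyc1).

Definition shift x : M := [ffun i => x (ordS i)].


Lemma iter_ordS k (i : 'I_n) : val (iter k (@ordS n) i) = (i + k) %% n :> nat.
Proof.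
elim: k => [|k IH] /=; first by rewrite addn0 modn_small.
by rewrite IH -addn1 modnDml addn1 addnS.
Qed.

Lemma iter_ordS_period (i : 'I_n) : iter n (@ordS n) i = i.
Proof. by apply: val_inj; rewrite iter_ordS modnDr modn_small. Qed.

Lemma iter_ordS0 (i : 'I_n) : iter i (@ordS n) ord0 = i.
Proof. by apply: val_inj; rewrite iter_ordS add0n modn_small. Qed.

Lemma iter_shift k x i : iter k shift x i = x (iter k (@ordS n) i).
Proof. by elim: k i => //= k IH i; rewrite ffunE IH -iterSr. Qed.

Lemma iter_shift_period x : iter n shift x = x.
Proof. by apply/ffunP => i; rewrite iter_shift iter_ordS_period. Qed.

(** Each application of [ockneg] moves one place and flips the bit, so only the parity of [k] and
    the total displacement survive. *)
Lemma iter_neg k x i : iter k ockneg x i = odd k (+) x (iter k (@ordS n) i).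
Proof. by elim: k i => //= k IH i; rewrite cycN IH -iterSr addNb. Qed.

Lemma compl_cyc x i : iter n ockneg x i = ~~ x i.
Proof. by rewrite iter_neg iter_ordS_period /= odd_double. Qed.

Lemma shift_term x : shift x = iter n.+1 ockneg x.
Proof. by apply/ffunP => i; rewrite ffunE iterS cycN compl_cyc negbK. Qed.

Lemma iter_shift_term k x : iter k shift x = iter (k * n.+1) ockneg x.
Proof. by elim: k => //= k ->; rewrite shift_term -iterD. Qed.

(** Shifting by [i] brings coordinate [i] to position 0, so bit 0 along the whole orbit recovers the
    vector. *)
Lemma cyc_ext x y :
  (forall k, iter k shift x ord0 = iter k shift y ord0) -> x = y.
Proof.
move=> xy; apply/ffunP => i.
by have := xy i; rewrite !iter_shift iter_ordS0.
Qed.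

End Cyclic.

(** * Homomorphisms into the cyclic algebra, subdirect irreducibility, compatibility *)

Lemma ockham_hom_iter d (A B : ockhamType d) (h : A -> B) k a :
  ockham_hom h -> h (iter k ockneg a) = iter k ockneg (h a).
Proof. by case=> _ _ hN _ _; elim: k => //= k <-. Qed.

Section CyclicProperties.
Variables (d : Order.disp_t) (m : nat).
Local Notation n := m.*2.+1.
Local Notation M := (cyc d m : ockhamType d).
Local Notation shift := (@shift d m).

(** [A] comes with no shift of its own; an iterate of [ockneg] stands in for it. *)
Lemma hom_shift (A : ockhamType d) (h : A -> M) k a : ockham_hom h ->
  iter k shift (h a) = h (iter (k * n.+1) ockneg a).
Proof. by move=> hh; rewrite iter_shift_term ockham_hom_iter. Qed.

(* A homomorphism into [M] is determined by the ultrafilter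
   [{a | h a ord0}], and ultrafilters are maximal. *)
Lemma hom_cyc_eq (A : ockhamType d) (h k : A -> M) :
  ockham_hom h -> ockham_hom k ->
  (forall a, h a ord0 -> k a ord0) -> h = k.
Proof.
move=> hh hk hle; have heq a : h a ord0 = k a ord0.
  apply/idP/idP => [/hle//|]; apply: contraLR => ha.
  have := hle (iter n ockneg a).
  by rewrite !ockham_hom_iter // !compl_cyc; apply.
by apply/funext => a; apply: cyc_ext => j; rewrite !hom_shift.
Qed.

Lemma finite_cyc : finite_set [set: M].
Proof. exact: (@finite_finset {ffun 'I_n -> bool}). Qed.

(** Simplicity in disguise: a coordinate of [h] that separates [\bot] from [\top] is injective, and
    it is onto by assumption. *)
Lemma cyc_subdirectly_irreducible : subdirectly_irreducible M.
Proof.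
move=> I B h hh hinj hsurj.
have [i hi] : exists i, h \bot i <> h \top i.
  apply: contrapT => /forallNP hi.
  have /hinj/ffunP/(_ ord0) : h \bot = h \top.
    by apply: functional_extensionality_dep => i; apply: contrapT; exact: hi.
  by rewrite !cycE.
have hih : ockham_hom (fun a => h a i).
  by case: hh => hU hI hN h0 h1; split=> *; rewrite ?hU ?hI ?hN ?h0 ?h1.
(* If [c] has a true bit and collapses to [\bot], so do all its shifts and hence their join, which
   is [\top]; this contradicts the choice of [i]. *)
have kernel c : h c i = h \bot i -> c = \bot.
  move=> hc; apply/ffunP => j; rewrite cyc0; apply/negP => cj; apply: hi.
  have hk k : h (iter k shift c) i = h \bot i.
    rewrite iter_shift_term (ockham_hom_iter _ _ hih) hc -(ockham_hom_iter _ _ hih).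
    congr (h _ i); rewrite -iter_shift_term; apply/ffunP => l.
    by rewrite iter_shift !cyc0.
  have hU : forall k, h (\big[@Order.join d M / \bot]_(l < k) iter l shift c) i = h \bot i.
    elim=> [|k IH]; first by rewrite big_ord0.
    rewrite big_ord_recr /=; case: hih => -> _ _ _ _.
    by rewrite IH hk joinxx.
  rewrite -(hU n); congr (h _ i); apply/ffunP => l; rewrite cyc1.
  have cyc_bigU : forall k (F : 'I_k -> M),
      (\big[@Order.join d M / \bot]_(l < k) F l) l = [exists l0, F l0 l].
    move=> k F; rewrite (big_morph (fun x : M => x l) (id1 := false) (op1 := orb)).
    - by rewrite big_orE; apply/eq_existsb.
    - by move=> x y; exact: cycU.
    - exact: cyc0.
  rewrite cyc_bigU; apply/existsP.
  (* The rotation taking position [l] to [j] is by [j - l] modulo [n]; adding [n - l] instead keeps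
     the subtraction from truncating. *)
  exists (Ordinal (ltn_pmod (j + (n - l)) (ltn0Sn _))); rewrite iter_shift /=.
  suff -> : iter ((j + (n - l)) %% n) (@ordS n) l = j by [].
  apply: val_inj; rewrite iter_ordS modnDmr addnCA subnKC ?modnDr ?modn_small //.
  exact: ltnW.
exists i; split=> //; have injh : injective (fun a => h a i).
  (* The meet of [a] with the complement of [b] collapses to [\bot], so it is [\bot] by [kernel]. *)
  have sep a b : h a i = h b i -> forall j, a j -> b j.
    move=> hab j aj; apply/negPn/negP => bj.
    have /ffunP/(_ j) : a `&` iter n ockneg b = \bot.
      have [_ hI _ _ _] := hih; apply: kernel.
      rewrite (hI a) hab -(hI b); congr (h _ i).
      apply/ffunP => l; rewrite cycI compl_cyc cyc0.
      exact: andbN.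
    by rewrite cycI compl_cyc cyc0 aj bj.
  move=> a b hab; apply/ffunP => j; apply/idP/idP; exact: sep.
have /choice[g gK] := hsurj i.
by exists g => // a; apply: injh; rewrite gK.
Qed.

Lemma shift_hom : ockham_hom shift.
Proof.
split=> *; apply/ffunP => i; rewrite !(ffunE, cycE) //.
Qed.

Lemma cyc_compatible : compatible shift eq.
Proof.
split; first exact: shift_hom.
by split=> //= [[a1 a2] [b1 b2] /= -> ->|[a1 a2] [b1 b2] /= -> ->|[a1 a2] /= ->].
Qed.

End CyclicProperties.

(** The cardinalities, powers of 2 with exponents [i.*2.+1] and [j.*2.+1], already differ. *)
Lemma cyc_not_iso d i j : i <> j ->
  ~ exists h : (cyc d i : ockhamType d) -> (cyc d j : ockhamType d), ockham_iso h.
Proof.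
move=> ij [h [_ /bij_eq_card]].
rewrite !card_ffun !card_ord card_bool => /eqP.
by rewrite eqn_exp2l // eqSS -!muln2 eqn_pmul2r // => /eqP.
Qed.

(** * Locally constant maps (continuous maps to discrete spaces) and compactness *)

Definition locally_constant (T : topologicalType) (V : Type) (f : T -> V) :=
  forall x, nbhs x [set y | f y = f x].

Lemma locally_constant_closed (T : topologicalType) (V : Type) (f : T -> V)
  (S : set V) : locally_constant f -> closed (f @^-1` S).
Proof. by move=> fc x /(_ _ (fc x))[y [/= Sy <-]]. Qed.

Lemma locally_constant_clopen (T : topologicalType) (V : Type) (f : T -> V)
  (S : set V) : locally_constant f -> clopen (f @^-1` S).
Proof.
move=> fc; split; last exact: locally_constant_closed.
by rewrite openE => x Sx; apply: filterS (fc x) => y /= ->.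
Qed.

Lemma locally_constant_comp (T : topologicalType) (V W : Type) (g : V -> W)
  (f : T -> V) : locally_constant f -> locally_constant (g \o f).
Proof. by move=> fc x; apply: filterS (fc x) => y /= ->. Qed.

(** The sets [B j] form the base of a proper filter; a cluster point of it lies in each of them
    because they are closed. All compactness arguments of the duality take this form. *)
Lemma compact_directed (T : topologicalType) (J : Type) (P : set J)
    (B : J -> set T) :
  compact [set: T] -> P !=set0 ->
  (forall j k, P j -> P k -> exists2 l, P l & B l `<=` B j `&` B k) ->
  (forall j, P j -> closed (B j)) -> (forall j, P j -> B j !=set0) ->
  exists x, forall j, P j -> B j x.
Proof.
move=> cT [j0 Pj0] dir clB B0.
have FF : ProperFilter (filter_from P B).
  by apply: filter_from_proper => //; apply: filter_from_filter; first exists j0.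
have [x [_ Fx]] := cT _ FF filterT.
exists x => j Pj; apply: clB => // U; apply: Fx; first by exists j.
Qed.

Lemma compact_set_type (T : topologicalType) (S : set T) :
  compact S -> compact [set: set_type S].
Proof.
move=> cS F FF _.
have FS : (val @ F) S.
  by have : F (val @^-1` S) by apply: filterE => x; exact: set_mem (valP x).
have [x [Sx Fx]] := cS (val @ F) _ FS.
exists (to_sub Sx); split=> // A U FA [_ [[V oV <-] Vx VU]].
have : (val @ F) (val @` A).
  by have : F (val @^-1` (val @` A)) by apply: filterS FA => y Ay; exists y.
move=> /Fx /(_ (open_nbhs_nbhs (conj oV Vx)))[_ [[y Ay <-] Vy]].
by exists y; split=> //; exact: VU.
Qed.

Lemma hausdorff_set_type (T : topologicalType) (S : set T) :
  hausdorff_space T -> hausdorff_space (set_type S).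
Proof.
move=> hT x y xy; apply: val_inj; apply: hT => A B nA nB.
have vc := @initial_continuous (set_type S) T val.
have [z [Az Bz]] := xy _ _ (vc _ _ nA) (vc _ _ nB).
by exists (val z).
Qed.

Lemma closed_eq_maps (T Z : topologicalType) (f g : T -> Z) :
  hausdorff_space Z -> continuous f -> continuous g ->
  closed [set x | f x = g x].
Proof.
move=> hZ fc gc x cx; apply: hZ => A B nA nB.
have fA : nbhs x (f @^-1` A) := fc x A nA.
have gB : nbhs x (g @^-1` B) := gc x B nB.
have [y [/= fgy [Afy Bgy]]] := cx _ (filterI fA gB).
by exists (f y); split=> //; rewrite fgy.
Qed.

Lemma dense_eq_maps (X : Type) (T Z : topologicalType) (i : X -> T)
    (f g : T -> Z) :
  hausdorff_space Z -> dense (range i) -> continuous f -> continuous g ->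
  f \o i = g \o i -> f = g.
Proof.
move=> hZ di fc gc fgi; apply/funext => x.
apply: (closed_eq_maps hZ fc gc) => V.
rewrite nbhsE => -[U [oU Ux] UV].
have [z [Uz [y _ yz]]] := di U (ex_intro _ x Ux) oU.
exists (i y); split; last by apply: UV; rewrite yz.
exact: (congr1 (@^~ y) fgi).
Qed.

(** * Powers of a discrete space and their subspaces *)

Section DiscretePowers.
Variables (M : choiceType) (I : Type).
Local Notation P := (prod_topology (fun _ : I => discrete_topology M)).
Implicit Types S : set P.

Lemma proj_locally_constant (i : I) : locally_constant (fun x : P => x i).
Proof.
move=> x; have := @proj_continuous {classic I} (fun _ => discrete_topology M) i x.
by move=> /(_ [set x i]); apply; exact: (@discrete_set1 (discrete_topology M)).
Qed.

Lemma compact_discrete_pow : finite_set [set: M] -> compact [set: P].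
Proof.
move=> finM; have := @tychonoff {classic I} (fun _ => discrete_topology M)
  (fun _ => setT) 
  (fun _ => @finite_compact (discrete_topology M) setT finM).
by congr compact; apply/seteqP; split.
Qed.

Lemma hausdorff_discrete_pow : hausdorff_space P.
Proof.
exact: (@hausdorff_product {classic I} (fun _ => discrete_topology M)
  (fun _ => @discrete_hausdorff _)).
Qed.

(** Three coordinates suffice for one homomorphism equation: the two arguments of a binary operation
    and its result. *)
Lemma closure_pow3 S x (i j k : I) : closure S x ->
  exists2 y, S y & [/\ y i = x i, y j = x j & y k = x k].
Proof.
have p l := proj_locally_constant l x.
move=> /(_ _ (filterI (p i) (filterI (p j) (p k))))[y [Sy [yi [yj yk]]]].
by exists y.
Qed.

Lemma proj_sub_locally_constant S (i : I) :
  locally_constant (fun x : set_type S => val x i : M).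
Proof.
move=> x; have vc := @initial_continuous (set_type S) P val x.
exact: (vc _ (proj_locally_constant i (val x))).
Qed.

Lemma continuous_sub_pow (T : topologicalType) S (f : T -> set_type S) :
  (forall i, locally_constant (fun x => val (f x) i : M)) -> continuous f.
Proof.
move=> fc; apply: (@continuous_comp_initial _ _ P) => x.
apply/cvg_sup => i A /= [_ [[V oV <-] Vx VA]]; rewrite nbhs_simpl /=.
by apply: filterS (fc i x) => y yx; apply: VA => /=; exact: (eq_ind_r V Vx yx).
Qed.

Lemma zero_dimensional_sub_pow S : zero_dimensional (set_type S).
Proof.
move=> x y /eqP xy.
have [i xyi] : exists i, val x i <> val y i.
  apply: contrapT => /forallNP xyi; apply/xy/val_inj/funext => i.
  exact: contrapT.
exists [set z | val z i = val x i]; split=> //; last exact: nesym.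
exact: (locally_constant_clopen [set val x i] (proj_sub_locally_constant i)).
Qed.

End DiscretePowers.

(** Compactness upgrades separation of points by clopen sets to a clopen neighbourhood base. *)
Lemma zero_dimensional_basis (T : topologicalType) :
  hausdorff_space T -> zero_dimensional T -> compact [set: T] ->
  basis (@clopen T).
Proof.
move=> hT zT cT; split=> [U [] //|x U].
by move=> /(zero_dimensional_cvg hT zT cT)[D [Dx cD] DU]; exists D.
Qed.

(** * The duality on the algebra side *)

Lemma ockham_hom_comp d (A B C : ockhamType d) (g : B -> C) (f : A -> B) :
  ockham_hom g -> ockham_hom f -> ockham_hom (g \o f).
Proof.
case=> gU gI gN g0 g1 [fU fI fN f0 f1].
by split=> *; rewrite /= ?fU ?fI ?fN ?f0 ?f1.
Qed.

Lemma ockham_sub_proj_hom d (M : ockhamType d) (I : Type)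
  (S : set (ockham_pow M I)) (hS : subalgebra S) (i : I) :
  ockham_hom (fun a : ockham_sub hS => val a i : M).
Proof. by []. Qed.

Lemma eval_alg_hom d (M A : ockhamType d) (u : M -> M) (le : M -> M -> Prop)
  (C : compatible u le) : ockham_hom (@eval_alg d M u le C A).
Proof.
split=> [a b|a b|a||]; apply: val_inj; apply/funext => x;
  have [xU xI xN x0 x1] := set_mem (valP x);
  [exact: xU|exact: xI|exact: xN|exact: x0|exact: x1].
Qed.

Section Duality.
Variables (d : Order.disp_t) (m : nat).
Local Notation M := (cyc d m : ockhamType d).
Local Notation shift := (@shift d m).
Local Notation NT := (alter_egoT shift eq).
Local Notation C := (cyc_compatible d m).

Lemma closed_dual_set (A : ockhamType d) :
  closed (@dual_set d M shift eq A).
Proof.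
move=> x cx; split=> [a b|a b|a||].
- have [y [yU _ _ _ _] [/= <- <- <-]] := closure_pow3 (a `|` b) a b cx.
  exact: yU.
- have [y [_ yI _ _ _] [/= <- <- <-]] := closure_pow3 (a `&` b) a b cx.
  exact: yI.
- have [y [_ _ yN _ _] [/= <- <- _]] := closure_pow3 (ockneg a) a a cx.
  exact: yN.
- by have [y [_ _ _ y0 _] [/= <- _ _]] := closure_pow3 \bot \bot \bot cx.
- by have [y [_ _ _ _ y1] [/= <- _ _]] := closure_pow3 \top \top \top cx.
Qed.

Lemma compact_dualD (A : ockhamType d) : compact [set: dualD C A].
Proof.
apply: compact_set_type.
have cP := @compact_discrete_pow M A (finite_cyc d m).
exact: (subclosed_compact (@closed_dual_set A) cP).
Qed.

Lemma tstr_hom_iter (X Y : tstr) (h : X -> Y) k x :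
  tstr_hom h -> h (iter k (@tu X) x) = iter k (@tu Y) (h x).
Proof. by case=> _ [hu _]; elim: k => //= k <-; exact: hu. Qed.

(** The coordinates of an embedding of [A] into a power of [M] are themselves points of the dual. *)
Lemma ISP_separated (A : ockhamType d) (a b : A) : alg_ISP M A ->
  (forall x : dualD C A, val x a = val x b) -> a = b.
Proof.
move=> [I [S [hS [h [hh hbij]]]]] ab.
apply: (bij_inj hbij); apply: val_inj; apply/funext => i.
have xP := ockham_hom_comp (ockham_sub_proj_hom hS i) hh.
exact: (ab (to_sub xP)).
Qed.


Section EvalAlg.
Variable A : ockhamType d.
Local Notation D := (dualD C A).

Let dual_hom (x : D) : ockham_hom (val x : A -> M).
Proof. exact: set_mem (valP x). Qed.

(** The Stone set of [a], with [x] read as the ultrafilter of those [a] for which bit 0 of [x a] is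
    true. *)
Let B (a : A) : set D := [set x | (val x a : M) ord0].

Let B_clopen a : clopen (B a).
Proof.
exact: (locally_constant_clopen [set y : M | y ord0]
  (@proj_sub_locally_constant M A (@dual_set d M shift eq A) a)).
Qed.

(** Stone's representation of clopen sets, by two uses of compactness: one shows that the sets [B a]
    form a base at each point of [K], the other that a single one covers [K]. *)
Lemma clopen_dualD (K : set D) : clopen K -> exists a, K = B a.
Proof.
move=> [oK cK]; have cD := @compact_dualD A.
have B1 : B \top = setT.
  apply/seteqP; split=> // x _; rewrite /B /=.
  by case: (dual_hom x) => _ _ _ _ ->; rewrite cyc1.
have BI a b : B (a `&` b) = B a `&` B b.
  apply/seteqP; split=> x; rewrite /B /=;
  case: (dual_hom x) => _ -> _ _ _; rewrite cycI; first by move/andP.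
  by move=> [-> ->].
have BU a b : B (a `|` b) = B a `|` B b.
  apply/seteqP; split=> x; rewrite /B /=;
  case: (dual_hom x) => -> _ _ _ _; rewrite cycU; first by move/orP.
  by move=> h; apply/orP.
have B0 : B \bot = set0.
  apply/seteqP; split=> // x; rewrite /B /=.
  by case: (dual_hom x) => _ _ _ -> _; rewrite cyc0.
(* Otherwise the sets [B a] minus [K], for [a] in the ultrafilter of [x], have a common point [y].
   Its ultrafilter contains that of [x], so [y = x] by maximality, although [y] is outside [K]. *)
have local x : K x -> exists2 a, B a x & B a `<=` K.
  move=> Kx; apply: contrapT => noa.
  have [||a Bax||y By] := @compact_directed D A [set a | B a x]
      (fun a => B a `&` ~` K) cD.
  - by exists \top; rewrite /= B1.
  - move=> a b /= Bax Bbx; exists (a `&` b); first by rewrite /= BI.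
    by rewrite BI => z [[? ?] ?].
  - by apply: closedI; [case: (B_clopen a)|exact: open_closedC].
  - move=> a Bax; apply: contrapT => nz; apply: noa; exists a => // z Baz.
    by apply: contrapT => nKz; apply: nz; exists z.
  have xy : val x = val y.
    by apply: hom_cyc_eq => // a Bax; have [] := By a Bax.
  have [_] : (B \top `&` ~` K) y by apply: By; rewrite /= B1.
  by apply; rewrite (_ : y = x) //; exact/val_inj/esym.
(* If no [B a] inside [K] exhausts [K], the remainders have a common point, which contradicts
   [local] at that point. *)
apply: contrapT => noa.
have [||a BaK||x Kx] := @compact_directed D A [set a | B a `<=` K]
    (fun a => K `\` B a) cD.
- by exists \bot; rewrite /= B0.
- move=> a b BaK BbK; exists (a `|` b); first by rewrite /= BU => z [/BaK|/BbK].
  by rewrite BU => z [Kz /not_orP[]].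
- by apply: closedI => //; apply: open_closedC; case: (B_clopen a).
- move=> a BaK; apply: contrapT => nz; apply: noa; exists a.
  apply/seteqP; split=> // z Kz; apply: contrapT => nBz; apply: nz.
  by exists z.
have [Kx' _] : (K `\` B \bot) x by apply: Kx; rewrite /= B0.
have [a Bax BaK] := local x Kx'.
by have [] := Kx a BaK.
Qed.

Lemma eval_alg_iso : alg_ISP M A -> ockham_iso (@eval_alg d M shift eq C A).
Proof.
move=> MA; split; first exact: eval_alg_hom.
have inj : injective (@eval_alg d M shift eq C A).
  move=> a b ab; apply: ISP_separated MA _ => x.
  exact: (congr1 (fun c : dualE C D => val c x : M) ab).
suff /choice[g gK] : forall c, exists a, @eval_alg d M shift eq C A a = c.
  by exists g => // a; apply: inj; rewrite gK.
move=> c; have hc : tstr_hom (val c : D -> NT) := set_mem (valP c).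
have /continuous_discrete cc := hc.1.
(* The clopen set where bit 0 of [c] is true names the preimage [a]; equivariance of [c] then yields
   the other bits. *)
have [a Ka] := clopen_dualD (@locally_constant_clopen _ _ _ [set y : M | y ord0] cc).
exists a; apply: val_inj; apply/funext => x; apply: cyc_ext => k.
rewrite -[RHS](congr1 (fun z : M => z ord0) (tstr_hom_iter k x hc)).
have tuE : val (iter k (@tu D) x) a = iter k shift (val x a : M).
  by elim: k => //= k <-.
by have /seteqP[KB BK] := Ka; apply/idP/idP; [rewrite -tuE => /BK|move=> /KB; rewrite -tuE].
Qed.

End EvalAlg.

End Duality.

(** * The duality on the structure side *)

Section EvalStr.
Variables (d : Order.disp_t) (m : nat).
Local Notation M := (cyc d m : ockhamType d).
Local Notation shift := (@shift d m).
Local Notation NT := (alter_egoT shift eq).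
Local Notation C := (cyc_compatible d m).

(** Transports the embedding into a power back to [X]: its coordinates become elements of the dual
    algebra that separate points and make continuity into [X] testable coordinatewise. *)
Lemma IScP_coordinates (X : tstr) : tstr_IScP NT X ->
  exists (I : Type) (c : I -> dualE C X),
    [/\ compact [set: X],
        (forall x y : X, (forall i, val (c i) x = val (c i) y :> M) -> x = y),
        (forall x y : X, tle x y <-> x = y) &
        forall (T : topologicalType) (f : T -> X),
          (forall i, locally_constant (fun t => val (c i) (f t) : M)) ->
          continuous f].
Proof.
move=> [I [S [hS [h [cS [g [hK gK [hc [hu hle]] [gc [_ gle]]]]]]]]].
have cP i : @tstr_hom X NT (fun x => val (h x) i).
  split; last by split=> x => [|y xy]; [rewrite hu|exact: hle xy i].
  apply/continuous_discrete => x.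
  exact: hc _ _ (@proj_sub_locally_constant M I S i (h x)).
exists I, (fun i => to_sub (cP i)); split.
- have cP' := @compact_discrete_pow M I (finite_cyc d m).
  have cT : compact [set: tstr_sub hS].
    by apply: compact_set_type; exact: (subclosed_compact cS cP').
  have -> : [set: X] = g @` setT.
    by apply/seteqP; split=> // x _; exists (h x).
  by apply: continuous_compact => //; exact: continuous_subspaceT.
- move=> x y xy; apply: (can_inj hK); apply: val_inj; apply/funext => i.
  exact: xy i.
- move=> x y; split=> [xy|->]; last by rewrite -(hK y); apply: gle.
  by apply: (can_inj hK); apply: val_inj; apply/funext => i; exact: hle xy i.
- move=> T f fc.
  have -> : f = g \o (h \o f) by apply/funext => t /=; rewrite hK.
  move=> t; apply: continuous_comp; last exact: gc.
  exact: (@continuous_sub_pow M I T S (h \o f)).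
Qed.

Lemma cyc_alg_ext (X : tstr) (a : dualE C X) (b : dualE C X) :
  (forall x : X, (val a x : M) ord0 = (val b x : M) ord0) -> a = b.
Proof.
move=> ab; apply: val_inj; apply/funext => x; apply: cyc_ext => k.
have ha : tstr_hom (val a : X -> NT) := set_mem (valP a).
have hb : tstr_hom (val b : X -> NT) := set_mem (valP b).
have := ab (iter k (@tu X) x).
by rewrite (tstr_hom_iter k x ha) (tstr_hom_iter k x hb).
Qed.

(** The ultrafilter given by bit 0 of [p] is fixed: by compactness some [x] lies in all its sets
    [B a], so it is contained in the ultrafilter of evaluation at [x], and [hom_cyc_eq] gives
    equality. *)
Lemma eval_str_surjective (X : tstr) (p : dualD C (dualE C X)) :
  compact [set: X] -> exists x, @eval_str d M shift eq C X x = p.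
Proof.
move=> cX; have hp : ockham_hom (val p : dualE C X -> M) := set_mem (valP p).
pose B (a : dualE C X) : set X := [set x | (val a x : M) ord0].
have [||a pa||x Bx] := @compact_directed X (dualE C X)
    [set a | (val p a : M) ord0] B cX.
- by exists \top => /=; case: hp => _ _ _ _ ->; rewrite cyc1.
- move=> a b pa pb; exists (a `&` b).
    by rewrite /=; case: hp => _ -> _ _ _; rewrite cycI pa.
  by move=> x; rewrite /B /= => /[!cycI]/andP.
- have [/continuous_discrete ac _] : tstr_hom (val a : X -> NT) := set_mem (valP a).
  exact: (@locally_constant_closed _ _ _ [set y : M | y ord0] ac).
- move=> a /= pa; apply: contrapT => noa; move: pa.
  (* An element with empty [B a] has bit 0 false everywhere, hence is [\bot], and [p] sends that to
     [\bot]. *)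
  have -> : a = \bot.
    apply: cyc_alg_ext => x; rewrite [RHS]cyc0; apply/negP => ax.
    by apply: noa; exists x.
  by case: hp => _ _ _ -> _; rewrite cyc0.
exists x; apply: val_inj; apply: esym.
have hx := ockham_sub_proj_hom (@dual_alg_subalgebra d M shift eq C X) x.
exact: (hom_cyc_eq hp hx Bx).
Qed.

Lemma eval_str_iso (X : tstr) :
  tstr_IScP NT X -> tstr_iso (@eval_str d M shift eq C X).
Proof.
move=> /IScP_coordinates[I [c [cX cinj leX cinit]]].
have /choice[g gK] := fun p => eval_str_surjective p cX.
have ginv : cancel (@eval_str d M shift eq C X) g.
  move=> x; apply: cinj => i.
  have := congr1 (fun p : dualD C (dualE C X) => val p (c i) : M) (gK (eval_str C x)).
  exact.
have evu x : eval_str C (@tu X x) = tu (eval_str C x).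
  apply: val_inj; apply/funext => a.
  by have [_ [au _]] : tstr_hom (val a : X -> NT) := set_mem (valP a); exact: au.
exists g; split=> //; split.
- apply: (@continuous_sub_pow M (dualE C X)) => a.
  by have [/continuous_discrete] : tstr_hom (val a : X -> NT) := set_mem (valP a).
- by split=> // x y /leX ->.
(* The coordinate [c i] of [g p] is just the value of [p] at [c i], which is locally constant in
   [p]. *)
- apply: cinit => i p.
  have := @proj_sub_locally_constant M (dualE C X) _ (c i) p.
  apply: filterS => q /= qp.
  have E := fun r => congr1 (fun p : dualD C (dualE C X) => val p (c i) : M) (gK r).
  by move: (E p) (E q) => /= -> ->.
- split=> [p|p q pq].
    have evgp : eval_str C (@tu X (g p)) = tu p by rewrite evu gK.
    by have := ginv (@tu X (g p)); rewrite evgp.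
  apply/leX; congr g; apply: val_inj; apply/funext => a; exact: pq.
Qed.

Lemma cyc_full_duality : full_duality C.
Proof. by split=> [A|X]; [exact: eval_alg_iso|exact: eval_str_iso]. Qed.

End EvalStr.

(** * Uniqueness of compactifications *)

Lemma tstr_hom_comp (X Y Z : tstr) (g : Y -> Z) (f : X -> Y) :
  tstr_hom g -> tstr_hom f -> tstr_hom (g \o f).
Proof.
move=> [gc [gu gle]] [fc [fu fle]]; split.
  by move=> x; apply: continuous_comp; [exact: fc|exact: gc].
split=> [x|x y xy]; first exact: etrans (congr1 g (fu x)) (gu _).
exact/gle/fle.
Qed.

Lemma tstr_hom_id (X : tstr) : tstr_hom (@id X).
Proof. by split=> // x. Qed.

Lemma compactification_unique (K : tstr -> Prop) (X : ostr) (b b' : tstr)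
    (i : X -> b) (i' : X -> b') :
  compactification K i -> compactification K i' -> iso_under i i'.
Proof.
have ext (c c' : tstr) (j : X -> c) (j' : X -> c') : compactification K j ->
    compactification K j' -> exists2 h : c -> c', tstr_hom h & h \o j = j'.
  move=> [_ _ _ univ] [Kc' [j'u _ j'le] _ _].
  have [|h [[hh hj] _]] := univ c' j' Kc'; last by exists h.
  by split=> // x y /j'le.
(* The universal property of [c] applied to [j] itself: both [h] and the identity extend [j]. *)
have fix_id (c : tstr) (j : X -> c) (h : c -> c) : compactification K j ->
    tstr_hom h -> h \o j = j -> forall x, h x = x.
  move=> [Kc [ju _ jle] _ univ] hh hj x.
  have [|k [_ kuniq]] := univ c j Kc; first by split=> // y z /jle.
  rewrite -(kuniq h) // (kuniq id) //; split=> //; exact: tstr_hom_id.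
move=> bi bi'; have [f fh fi] := ext _ _ _ _ bi bi'.
have [g gh gi] := ext _ _ _ _ bi' bi.
exists f; split=> //; exists g; split=> //.
- apply: (fix_id _ i (g \o f)) => //; first exact: tstr_hom_comp.
  by rewrite -compA fi gi.
- apply: (fix_id _ i' (f \o g)) => //; first exact: tstr_hom_comp.
  by rewrite -compA gi fi.
Qed.

(** * The natural extension as a compactification *)

Section NaturalExtension.
Variables (d : Order.disp_t) (m : nat) (X : ostr).
Local Notation n := m.*2.+1.
Local Notation M := (cyc d m : ockhamType d).
Local Notation shift := (@shift d m).
Local Notation N := (alter_ego shift eq).
Local Notation H := (@hom_set d M shift eq X).
Local Notation Y := (@nat_ext d M shift eq X).
Local Notation iota := (@nat_ext_map d M shift eq X).
Hypothesis XN : str_ISP N X.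

Lemma ISP_ole (Z : ostr) (x y : Z) : str_ISP N Z -> ole x y <-> x = y.
Proof.
move=> [I [S [hS [h [g [hK gK [hu hle] [gu gle]]]]]]]; split=> [xy|->].
  by apply: (can_inj hK); apply: val_inj; apply/funext => i; exact: hle xy i.
by rewrite -(hK y); apply: gle.
Qed.

Lemma ISP_separating (x y : X) : (forall phi : H, sval phi x = sval phi y) -> x = y.
Proof.
case: XN => [I [S [hS [h [g [hK gK [hu hle] _]]]]]] xy.
apply: (can_inj hK); apply: val_inj; apply/funext => i.
have cP : @ostr_hom X N (fun x => val (h x) i).
  by split=> [z|z t zt]; [rewrite hu|exact: hle zt i].
exact: (xy (exist _ _ cP)).
Qed.

(** The identity holds for the shift, and homomorphisms to [N] separate the points of [X]. *)
Lemma ISP_period (x : X) : iter n (@ou X) x = x.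
Proof.
apply: ISP_separating => -[phi [phiu phile]] /=.
have it k : phi (iter k (@ou X) x) = iter k shift (phi x).
  by elim: k => //= k <-; exact: phiu.
by have := it n; rewrite iter_shift_period.
Qed.

(** The equivariant lift of the characteristic function of [A]: bit [i] records whether the [i]-th
    iterate of [x] lies in [A]. Thus every subset of [X] is seen by some homomorphism. *)
Lemma char_hom_subproof (A : set X) :
  @ostr_hom X N (fun x => [ffun i : 'I_n => `[< A (iter i (@ou X) x) >]] : M).
Proof.
split=> [x|x y /(ISP_ole _ _ XN) -> //].
apply/ffunP => i; rewrite !ffunE -iterSr; congr asbool; congr A.
(* [ordS] wraps around at the last index; the period [n] of [ou] absorbs the wrap. *)
have perk k : iter (k * n) (@ou X) x = x.
  by elim: k => // k IH; rewrite mulSn addnC iterD ISP_period.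
by rewrite {1}(divn_eq i.+1 n) addnC iterD perk.
Qed.

Definition char_hom (A : set X) : H := exist _ _ (char_hom_subproof A).

Lemma char_homE (A : set X) x : (sval (char_hom A) x : M) ord0 = `[< A x >].
Proof. by rewrite ffunE. Qed.

Lemma compact_nat_ext : compact [set: Y].
Proof.
apply: compact_set_type.
have cP := @compact_discrete_pow M H (finite_cyc d m).
exact: (subclosed_compact (@closed_closure _ _) cP).
Qed.

Lemma hausdorff_nat_ext : hausdorff_space Y.
Proof. exact: (hausdorff_set_type (@hausdorff_discrete_pow M H)). Qed.

Lemma nat_ext_coord (phi : H) : locally_constant (fun y : Y => val y phi : M).
Proof. exact: (@proj_sub_locally_constant M H). Qed.

Lemma nat_ext_tu_continuous : continuous (@tu Y).
Proof.
apply: (@continuous_sub_pow M H) => phi.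
exact: (locally_constant_comp shift (nat_ext_coord phi)).
Qed.

Lemma nat_ext_tleE (x y : Y) : tle x y <-> x = y.
Proof.
split=> [xy|-> //]; apply: val_inj; apply/funext => phi; exact: xy.
Qed.

Lemma compact_str_nat_ext : compact_str N Y.
Proof.
split.
- exists H, (closure (range (@nat_eval d M shift eq X))).
  exists (@nat_ext_closed d M shift eq X), id, id.
  by split.
- by split; [exact: compact_nat_ext|exact: hausdorff_nat_ext].
- exact: nat_ext_tu_continuous.
- have -> : [set p : Y * Y | tle p.1 p.2] = [set p | p.1 = p.2].
    by apply/seteqP; split=> p /nat_ext_tleE.
  by apply: (closed_eq_maps hausdorff_nat_ext) => p; [exact: cvg_fst|exact: cvg_snd].
Qed.

Lemma boolean_str_nat_ext : boolean_str N Y.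
Proof.
split; first exact: compact_str_nat_ext.
exists (@clopen Y); split=> //.
apply: (zero_dimensional_basis hausdorff_nat_ext) compact_nat_ext.
exact: (@zero_dimensional_sub_pow M H).
Qed.

Lemma nat_ext_embedding : @ostr_embedding X (flat Y) iota.
Proof.
have iinj : injective iota.
  move=> x y xy; apply: ISP_separating => phi.
  exact: (congr1 (fun z : Y => val z phi : M) xy).
split=> // [x|x y].
- by apply: val_inj; apply/funext => -[phi [phiu phile]]; exact: phiu.
- rewrite (ISP_ole _ _ XN); split=> [->|/nat_ext_tleE/iinj //].
  exact/nat_ext_tleE.
Qed.

Lemma nat_ext_dense : dense (range iota).
Proof.
move=> O [y Oy] [V oV VO].
have Vy : V (val y) by move: Oy; rewrite -VO.
have [_ [[x _ <-] Vx]] := set_mem (valP y) V (open_nbhs_nbhs (conj oV Vy)).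
by exists (iota x); split; [rewrite -VO|exists x].
Qed.

(* The trace on [X] of the neighbourhood filter of [y] is an ultrafilter, so its
   image in a compact Hausdorff space converges. *)
Lemma trace_ultra (y : Y) (A : set X) :
  (exists2 V, nbhs y V & iota @^-1` V `<=` A) \/
  (exists2 V, nbhs y V & iota @^-1` V `<=` ~` A).
Proof.
pose V := [set z : Y | val z (char_hom A) = val y (char_hom A) :> M].
have yV : nbhs y V by exact: nat_ext_coord.
have VA x : V (iota x) -> `[< A x >] = (val y (char_hom A) : M) ord0.
  by move=> xV; rewrite -char_homE; congr (fun_of_fin _ ord0); exact: xV.
have [yA|yA] := boolP ((val y (char_hom A) : M) ord0); [left|right];
  exists V => // x /VA xA; apply/asboolP; rewrite ?asbool_neg xA //.
Qed.

Lemma extension_exists (Z : tstr) (g : X -> Z) :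
  compact [set: Z] -> hausdorff_space Z ->
  exists2 h : Y -> Z, continuous h & h \o iota = g.
Proof.
move=> cZ hZ.
have meets (y : Y) V : nbhs y V -> exists x, V (iota x).
  rewrite nbhsE => -[U [oU Uy] UV].
  have [z [Uz [x _ xz]]] := nat_ext_dense (ex_intro _ y Uy) oU.
  by exists x; apply: UV; rewrite xz.
(* The value at [y] is to be a limit of [g] along the trace of the neighbourhoods of [y].
   Compactness gives a cluster point, and [trace_ultra] makes it a limit. *)
have lim (y : Y) : exists z : Z, forall W, nbhs z W ->
    exists2 V, nbhs y V & iota @^-1` V `<=` g @^-1` W.
  pose F := filter_from (nbhs y) (fun V => g @` (iota @^-1` V)).
  have FF : ProperFilter F.
    apply: filter_from_proper; last first.
      by move=> V /meets[x Vx]; exists (g x), x.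
    apply: filter_from_filter; first by exists setT; exact: filterT.
    move=> V V' yV yV'; exists (V `&` V'); first exact: filterI.
    by move=> _ [x [Vx V'x] <-]; split; exists x.
  have [z [_ Fz]] := cZ F FF filterT.
  exists z => W zW; have [//|[V yV VW]] := trace_ultra y (g @^-1` W).
  have FV : F (g @` (iota @^-1` V)) by exists V.
  by have [_ [[x Vx <-] Wx]] := Fz _ _ FV zW; have := VW _ Vx.
have [h hlim] := choice lim; exists h.
(* By regularity of [Z], [W] contains the closure of a neighbourhood [W'] of [h y]; for [y'] near
   [y], each neighbourhood of [h y'] meets [W'] in some [g x]. *)
- move=> y W hyW.
  have [W' hyW' W'W] := compact_regular hZ cZ filterT hyW.
  have [V yV VW'] := hlim y _ hyW'.
  have : nbhs y V^° by exact: nbhs_interior.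
  apply: filterS => y' Vy'; apply: W'W => U hy'U.
  have [V' y'V' V'U] := hlim y' _ hy'U.
  have [x [Vx V'x]] := meets y' _ (filterI Vy' y'V').
  by exists (g x); split; [exact: VW'|exact: V'U].
- apply/funext => x; apply: hZ => A B hA gB.
  have [V xV VA] := hlim _ _ hA.
  exists (g x); split; last exact: nbhs_singleton.
  by apply: VA; exact: nbhs_singleton xV.
Qed.

(** Leaving [K] abstract settles the compact and the Boolean case together: the extension of maps
    requires of the target only that it be in [compact_str N]. *)
Lemma nat_ext_compactification (K : tstr -> Prop) :
  K Y -> (forall Z, K Z -> compact_str N Z) -> compactification K iota.
Proof.
move=> KY KN; split=> //; [exact: nat_ext_embedding|exact: nat_ext_dense|].
move=> Z g /KN[ZN [cZ hZ] uc _] [gu gle].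
have [h hc hi] := extension_exists g cZ hZ.
have [iu _ _] := nat_ext_embedding.
exists h; split; last first.
  move=> h' [[h'c _] h'i]; apply: (dense_eq_maps hZ nat_ext_dense) => //.
  by rewrite hi h'i.
split=> //; split=> //; split=> [y|y y' /nat_ext_tleE ->]; last first.
  by rewrite (ISP_ole _ _ ZN).
(* Two continuous maps into a Hausdorff space are compared on the dense image of [X], where [g]
   commutes with [u]. *)
have : h \o @tu Y = @tu Z \o h; last by move=> /(congr1 (@^~ y)).
apply: (dense_eq_maps hZ nat_ext_dense).
- by move=> x; apply: continuous_comp; [exact: nat_ext_tu_continuous|exact: hc].
- by move=> x; apply: continuous_comp; [exact: hc|exact: uc].
- apply/funext => x; have hx z : h (iota z) = g z := congr1 (@^~ z) hi.
  transitivity (@tu Z (g x)); last by rewrite -hx.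
  exact: etrans (congr1 h (esym (iu x))) (etrans (hx (ou x)) (gu x)).
Qed.

End NaturalExtension.

Theorem theorem6p8 (d : Order.disp_t) :
  exists Mfam : nat -> ockhamType d,
    (forall i j : nat, i <> j ->
       ~ exists h : Mfam i -> Mfam j, ockham_iso h) /\
    forall n : nat, let M1 := Mfam n in
      [/\ finite_set [set: M1],
          subdirectly_irreducible M1 &
          exists (u : M1 -> M1) (le : M1 -> M1 -> Prop),
            [/\ partial_order le,
                order_reversing u le,
                (exists C : compatible u le, full_duality C) &
                forall X : ostr, str_ISP (alter_ego u le) X ->
                  [/\ exists (b : tstr) (i : X -> b), bohr (alter_ego u le) i,
                      exists (b0 : tstr) (i0 : X -> b0), bohr0 (alter_ego u le) i0 &
                      forall (b b0 : tstr) (i : X -> b) (i0 : X -> b0),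
                        bohr (alter_ego u le) i -> bohr0 (alter_ego u le) i0 ->
                        iso_under i i0 /\ iso_under i0 (@nat_ext_map d M1 u le X)]]].
Proof.
exists (fun m => cyc d m : ockhamType d); split; first exact: cyc_not_iso.
move=> m M1; split; [exact: finite_cyc|exact: cyc_subdirectly_irreducible|].
exists (@shift d m), eq; split.
- by split=> // x y z ->.
- by move=> x y ->.
- exists (cyc_compatible d m); exact: cyc_full_duality.
move=> X XN.
have nb : bohr (alter_ego (@shift d m) eq) (@nat_ext_map d M1 (@shift d m) eq X).
  by apply: nat_ext_compactification => //; exact: compact_str_nat_ext.
have nb0 : bohr0 (alter_ego (@shift d m) eq) (@nat_ext_map d M1 (@shift d m) eq X).
  apply: nat_ext_compactification => //; first exact: boolean_str_nat_ext.
  by move=> Z [].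
split; [by exists (@nat_ext d M1 (@shift d m) eq X), (@nat_ext_map d M1 (@shift d m) eq X)
  |by exists (@nat_ext d M1 (@shift d m) eq X), (@nat_ext_map d M1 (@shift d m) eq X)|].
move=> b b0 i i0 bi b0i0; split; last exact: compactification_unique b0i0 nb0.
(* The isomorphism from [b] to [b0] is composed through the natural extension, which is a
   compactification of both kinds. *)
have [f [[f' [fK fK' fh f'h]] fi]] := compactification_unique bi nb.
have [g [[g' [gK gK' gh g'h]] gi]] := compactification_unique nb0 b0i0.
exists (g \o f); split; last by rewrite -compA fi gi.
exists (f' \o g'); split; [exact: can_comp|exact: can_comp
  |exact: tstr_hom_comp|exact: tstr_hom_comp].
Qed.
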